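(* Let $k=(\mathbb{F}_q,\mathrm{id})$ and let $A$ be an étale finitely $\boldsymbol{\sigma}$-presented $k$-algebra. Then the difference zeta function $$Z_A(t)=\exp\left(\sum_{n=1}^\infty\frac{N_n}{n}t^n\right),\qquad N_n=|k\text{-}\mathbf{Alg}(A,\bar{k}_n)|,$$ is near-rational, i.e. its logarithmic derivative is a rational function of $t$.
   Context: $\mathbb{F}_q$ is the finite field with $q$ elements. A difference ring is a commutative unital ring $R$ with an endomorphism $\sigma_R$, and $\lfloor R\rfloor$ is the underlying ring; morphisms commute with the endomorphisms. For a difference ring $k$, a $k$-algebra is a difference ring with a difference ring morphism from $k$, and $k\text{-}\mathbf{Alg}(A,B)$ is the set of $k$-algebra morphisms (commuting with $\sigma$). For $n\ge1$, $\bar{k}_n=(\bar{\mathbb{F}}_q,\varphi_n)$ with $\varphi_n(\alpha)=\alpha^{q^n}$, a $k$-algebra. A cocorrespondence $A_0\xrightarrow{p}C_0\xleftarrow{s}A_0$ of $\lfloor k\rfloor$-algebras consists of a $\lfloor k\rfloor$-algebra homomorphism $p$ and a ring homomorphism $s$ with $s(\lambda a)=\sigma_k(\lambda)s(a)$ for $\lambda\in k$. Its directly presented $k$-algebra $\lceil A_0;C_0|^k$ is the $k$-algebra representing the functor $B\mapsto\{c\in\lfloor k\rfloor\text{-}\mathbf{Alg}(C_0,\lfloor B\rfloor):\sigma_B\circ c\circ p=c\circ s\}$ on $k$-algebras. A $k$-algebra $A$ is étale finitely $\boldsymbol{\sigma}$-presented (finitely $\boldsymbol{\sigma}$-presented étale)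 if $A\simeq\lceil A_0;C_0|^k$ for some cocorrespondence of (finite-dimensional) étale $\lfloor k\rfloor$-algebras. *)

(* Defs.v *)
From HB Require Import structures.
From mathcomp Require Import all_boot all_algebra all_field.
From mathcomp Require Import boolp classical_sets functions cardinality.

Set Implicit Arguments.
Unset Strict Implicit.
Unset Printing Implicit Defensive.

Import GRing.Theory.
Local Open Scope classical_set_scope.
Local Open Scope ring_scope.

(* Rings are comPzRingType, so the zero ring is allowed: the empty product is  *)
(* an étale algebra, and a directly presented algebra may vanish.  MathComp's  *)
(* comAlgType excludes the zero ring, so algebras are given by their structure *)
(* morphism.                                                                   *)

Record algebra (k : comPzRingType) := MkAlgebra {
  algebra_ring :> comPzRingType;
  algebra_map : {rmorphism k -> algebra_ring} }.

Definition algebra_hom (k : comPzRingType) (A B : algebra k) : set (A -> B) :=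
  [set f | [/\ zmod_morphism f, monoid_morphism f
             & forall x, f (algebra_map A x) = algebra_map B x]].

Record diffRing := MkDiffRing {
  diff_ring :> comPzRingType;
  diff_sigma : {rmorphism diff_ring -> diff_ring} }.

Record diffAlgebra (k : diffRing) := MkDiffAlgebra {
  diffAlgebra_ring :> diffRing;
  diffAlgebra_map : {rmorphism k -> diffAlgebra_ring};
  diffAlgebra_mapP : forall x,
    diffAlgebra_map (diff_sigma k x)
      = diff_sigma diffAlgebra_ring (diffAlgebra_map x) }.

Definition floor (k : diffRing) (A : diffAlgebra k) : algebra k :=
  MkAlgebra (@diffAlgebra_map k A).

Definition diff_hom (k : diffRing) (A B : diffAlgebra k) : set (A -> B) :=
  [set f | algebra_hom (A := floor A) (B := floor B) f
           /\ forall a, f (diff_sigma A a) = diff_sigma B (f a)].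

Record cocorrespondence (k : diffRing) := MkCocorrespondence {
  cocorr_src : algebra k;
  cocorr_tgt : algebra k;
  cocorr_p : {rmorphism cocorr_src -> cocorr_tgt};
  cocorr_s : {rmorphism cocorr_src -> cocorr_tgt};
  cocorr_pP : forall (l : k),
    cocorr_p (algebra_map cocorr_src l) = algebra_map cocorr_tgt l;
  cocorr_sP : forall (l : k) (a : cocorr_src),
    cocorr_s (algebra_map cocorr_src l * a)
      = algebra_map cocorr_tgt (diff_sigma k l) * cocorr_s a }.

Definition cocorr_points (k : diffRing) (Q : cocorrespondence k)
    (B : diffAlgebra k) : set (cocorr_tgt Q -> B) :=
  [set c | algebra_hom (B := floor B) c
           /\ forall a, diff_sigma B (c (cocorr_p Q a)) = c (cocorr_s Q a)].

(* A represents the functor B |-> cocorr_points Q B: there is a bijection from *)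
(* diff_hom A B to it, natural in B.                                           *)
Definition directly_presented (k : diffRing) (Q : cocorrespondence k)
    (A : diffAlgebra k) : Prop :=
  exists Phi : forall B : diffAlgebra k, (A -> B) -> (cocorr_tgt Q -> B),
    (forall B, set_bij (diff_hom (A := A) (B := B)) (@cocorr_points k Q B)
                       (Phi B))
    /\ (forall (B B' : diffAlgebra k) (g : B -> B') (f : A -> B),
          diff_hom g -> diff_hom f -> Phi B' (g \o f) = g \o Phi B f).

(* A is isomorphic, via a |-> (pr i a)_i, to a finite product of finite        *)
(* separable field extensions of F.                                            *)
Definition etale (F : fieldType) (A : algebra F) : Prop :=
  exists (m : nat) (E : 'I_m -> fieldExtType F)
         (pr : forall i, {rmorphism A -> E i}),
    [/\ forall i, separable 1%VS {:E i}%VS,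
        forall i (x : F), pr i (algebra_map A x) = x%:A
      & bijective (fun (a : A) (i : 'I_m) => pr i a)].

Definition etale_finitely_sigma_presented (F : fieldType)
    (sigma : {rmorphism F -> F}) (A : diffAlgebra (MkDiffRing sigma)) : Prop :=
  exists Q : cocorrespondence (MkDiffRing sigma),
    [/\ @etale F (cocorr_src Q), @etale F (cocorr_tgt Q)
      & directly_presented Q A].

Definition finite_field_diff (F : finFieldType) : diffRing :=
  MkDiffRing (idfun : {rmorphism F -> F}).

Definition is_algebraic_closure (F : fieldType) (K : closedFieldType)
  (iota : {rmorphism F -> K}) : Prop := forall z : K, algebraicOver iota z.

(* iota is used only through the fact that K has the characteristic of F,      *)
(* which makes frob a ring morphism.                                           *)
Definition frob (F : finFieldType) (K : fieldType) (iota : {rmorphism F -> K})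
  (n : nat) (x : K) : K := x ^+ (#|F| ^ n)%N.

Fact frob_zmod_morphism (F : finFieldType) (K : fieldType)
  (iota : {rmorphism F -> K}) (n : nat) : zmod_morphism (frob iota n).
Proof.
have [p p_pr pF] := finPcharP F.
have pK : p \in [pchar K] by rewrite (fmorph_pchar iota).
have cardF : #|F| = (p ^ logn p #|F|)%N := card_pprimeChar pF.
have qK : [pchar K].-nat (#|F| ^ n)%N.
  rewrite (eq_pnat _ (pcharf_eq pK)) cardF -expnM pnatX.
  by apply/orP; left; rewrite pnat_id.
move=> x y; rewrite /frob exprDn_pchar // exprNn.
have [q_odd|q_even] := boolP (odd (#|F| ^ n)%N).
  by rewrite -signr_odd q_odd expr1 mulN1r.
suff yN : y ^+ (#|F| ^ n)%N = - y ^+ (#|F| ^ n)%N.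
  by rewrite -signr_odd (negbTE q_even) expr0 mul1r {1}yN.
have p2 : p = 2%N.
  apply/eqP; apply: contraR q_even => p_neq2.
  rewrite cardF -expnM oddX; apply/orP; right.
  by case: (even_prime p_pr) => // p2; rewrite p2 eqxx in p_neq2.
by rewrite oppr_pchar2 // -p2.
Qed.

Fact frob_monoid_morphism (F : finFieldType) (K : fieldType)
  (iota : {rmorphism F -> K}) (n : nat) : monoid_morphism (frob iota n).
Proof. by split=> [|x y]; rewrite /frob ?expr1n ?exprMn. Qed.

HB.instance Definition _ (F : finFieldType) (K : fieldType)
  (iota : {rmorphism F -> K}) (n : nat) :=
  Algebra.isZmodMorphism.Build K K (frob iota n) (frob_zmod_morphism iota n).
HB.instance Definition _ (F : finFieldType) (K : fieldType)
  (iota : {rmorphism F -> K}) (n : nat) :=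
  GRing.isMonoidMorphism.Build K K (frob iota n) (frob_monoid_morphism iota n).

Definition frob_diff (F : finFieldType) (K : fieldType)
  (iota : {rmorphism F -> K}) (n : nat) : diffRing :=
  MkDiffRing (frob iota n : {rmorphism K -> K}).

Fact frob_fixed (F : finFieldType) (K : fieldType)
  (iota : {rmorphism F -> K}) (n : nat) (x : F) :
  iota x = frob iota n (iota x).
Proof.
rewrite /frob -rmorphXn; congr (iota _).
by elim: n => [|n IHn]; rewrite ?expr1 // expnSr exprM -IHn expf_card.
Qed.

Definition kbar (F : finFieldType) (K : closedFieldType)
  (iota : {rmorphism F -> K}) (n : nat) : diffAlgebra (finite_field_diff F) :=
  @MkDiffAlgebra (finite_field_diff F) (frob_diff iota n) iota
                 (frob_fixed iota n).

(* The cardinality of a finite set, and 0 on infinite sets. *)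
Definition ncard (T : Type) (S : set T) : nat :=
  xget 0%N [set m : nat | (S #= `I_m)%card].

Definition hom_count (F : finFieldType) (K : closedFieldType)
  (iota : {rmorphism F -> K}) (A : diffAlgebra (finite_field_diff F))
  (n : nat) : nat := ncard (diff_hom (A := A) (B := kbar iota n)).

(* Formal power series over rat, as coefficient sequences. *)
Definition fps := nat -> rat.

Definition fps_poly (P : {poly rat}) : fps := fun n => P`_n.

Definition fps_mul (f g : fps) : fps :=
  fun n => \sum_(i < n.+1) f i * g (n - i)%N.

Definition fps_exprn (f : fps) (j : nat) : fps :=
  iter j (fps_mul f) (fps_poly 1).

Definition fps_deriv (f : fps) : fps := fun n => f n.+1 *+ n.+1.

(* For f with zero constant term, f^j has no term of degree n < j, so the sum  *)
(* over j of f^j / j! stops at j = n in degree n.                              *)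
Definition fps_exp (f : fps) : fps :=
  fun n => \sum_(j < n.+1) fps_exprn f j n / (j`!)%:R.

(* f = P / Q. *)
Definition fps_rational (f : fps) : Prop :=
  exists P Q : {poly rat}, Q != 0 /\ fps_mul (fps_poly Q) f = fps_poly P.

(* L = f' / f; meaningful for f != 0. *)
Definition is_log_deriv (f L : fps) : Prop := fps_mul L f = fps_deriv f.

Definition near_rational (f : fps) : Prop :=
  exists L : fps, is_log_deriv f L /\ fps_rational L.

Definition diff_zeta (F : finFieldType) (K : closedFieldType)
  (iota : {rmorphism F -> K}) (A : diffAlgebra (finite_field_diff F)) : fps :=
  fps_exp (fun n => if n is 0%N then 0 else (hom_count iota A n)%:R / n%:R).

(* Main.v *)
Require Import Defs.
From HB Require Import structures.
From mathcomp Require Import all_boot all_algebra all_field.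
From mathcomp Require Import boolp classical_sets functions cardinality.

Set Implicit Arguments.
Unset Strict Implicit.
Unset Printing Implicit Defensive.

Import GRing.Theory Num.Theory.
Local Open Scope classical_set_scope.
Local Open Scope ring_scope.

(** Let [Q], given by [p, s : A0 -> C0], be a cocorrespondence presenting [A],
    and let [q] be the cardinality of [F].  By representability, [N_n] counts
    the algebra morphisms [c : C0 -> K] such that
    [(c (p a)) ^+ (q ^ n) = c (s a)] for all [a].

    An étale algebra over a finite field is a finite product of finite fields,
    so all its elements are fixed by a common power of the Frobenius: there is
    [d > 0] with [a ^+ (q ^ d) = a] ([etale_frob_period]).  For [C0] this
    confines the values of every [c] to the roots of one polynomial, and since
    [C0] is a finite set there are finitely many [c]
    ([finite_etale_algebra_hom]).  For [A0] it shows that the condition on [c]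
    depends only on [n] modulo [d], so [N_n] is periodic in [n]
    ([hom_count_periodic]).

    The chain rule for the exponential ([fps_exp_log_deriv]) identifies the
    logarithmic derivative of the zeta function with the sum of the
    [N_(n+1) t^n]; a periodic sequence of coefficients of period [d] gives a
    rational function of denominator [1 - t^d] ([fps_rational_periodic]). *)

(** * Formal power series *)

(** Coefficients of products and powers of series up to a given degree are
    those of the truncations, so identities between series can be borrowed from
    the ring of polynomials. *)
Definition fps_trunc (N : nat) (f : fps) : {poly rat} := \poly_(i < N) f i.

Lemma coef_fps_trunc N f i : (i < N)%N -> (fps_trunc N f)`_i = f i.
Proof. by move=> ltiN; rewrite coef_poly ltiN. Qed.

Lemma fps_exprn_trunc N f j n : (n < N)%N ->
  fps_exprn f j n = (fps_trunc N f ^+ j)`_n.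
Proof.
elim: j n => [|j IHj] n ltnN; first by rewrite expr0.
rewrite exprS coefM; apply: eq_bigr => i _.
rewrite -IHj ?coef_fps_trunc //.
  by rewrite (leq_ltn_trans _ ltnN) // -ltnS.
by rewrite (leq_ltn_trans (leq_subr _ _)).
Qed.

Lemma fps_exprn_eq0 f j n : f 0%N = 0 -> (n < j)%N -> fps_exprn f j n = 0.
Proof.
move=> f0; elim: j n => [//|j IHj] n ltnj.
rewrite [LHS]/(fps_mul f (fps_exprn f j) n) /fps_mul.
apply: big1 => -[[|i] /= ltin] _; first by rewrite f0 mul0r.
rewrite IHj ?mulr0 //.
by rewrite ltn_subLR // addSn (leq_trans ltnj) // ltnS leq_addl.
Qed.

Lemma fps_deriv_exprn f j n :
  fps_deriv (fps_exprn f j.+1) n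
    = fps_mul (fps_deriv f) (fps_exprn f j) n *+ j.+1.
Proof.
rewrite /fps_deriv (@fps_exprn_trunc n.+2) // -coef_deriv deriv_exp /=.
rewrite coefMn; congr (_ *+ _); rewrite coefM.
apply: eq_bigr => i _; rewrite coef_deriv coef_fps_trunc ?ltnS; last first.
  by rewrite -ltnS ltn_ord.
by rewrite -fps_exprn_trunc // ltnS (leq_trans (leq_subr _ _)).
Qed.

(** The rule [(exp f)' = f' exp f], obtained termwise from
    [(f^j / j!)' = f' f^(j-1) / (j-1)!].  Truncating the sum over [j] at the
    degree is harmless because [f ^ j] vanishes below degree [j]. *)
Lemma fps_exp_log_deriv f :
  f 0%N = 0 -> is_log_deriv (fps_exp f) (fps_deriv f).
Proof.
move=> f0; apply/funext => n; rewrite {2}/fps_deriv /fps_exp.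
(* The constant term [j = 0] of the exponential has derivative zero. *)
rewrite big_ord_recl /= {1}/fps_poly coef1 /= mul0r add0r -sumrMnl.
transitivity (\sum_(j < n.+1) fps_mul (fps_deriv f) (fps_exprn f j) n
                                / (j`!)%:R).
  under [RHS]eq_bigr do rewrite mulr_suml.
  rewrite exchange_big; apply: eq_bigr => i _ /=; rewrite mulr_sumr.
  have len : (i <= n)%N by rewrite -ltnS.
  rewrite (big_ord_widen n.+1
    (fun j => fps_deriv f i * (fps_exprn f j (n - i)%N / (j`!)%:R)));
    last by rewrite ltnS leq_subr.
  rewrite big_mkcond; apply: eq_bigr => j _.
  rewrite ltnS; case: leqP => [_|ltj]; first by rewrite mulrA.
  by rewrite fps_exprn_eq0 // mulr0 mul0r.
apply: eq_bigr => j _; rewrite /bump leq0n add1n.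
have := fps_deriv_exprn f j n; rewrite /fps_deriv -mulrnAl => ->.
rewrite factS natrM invfM mulrA -[_ *+ j.+1]mulr_natr mulfK //.
by rewrite pnatr_eq0.
Qed.

(** Multiplying by [1 - t^d] leaves only the terms of the first period. *)
Lemma fps_rational_periodic d (f : fps) : (0 < d)%N ->
  (forall n, f (n + d)%N = f n) -> fps_rational f.
Proof.
move=> d_gt0 fP; exists (fps_trunc d f), (1 - 'X^d); split.
  by rewrite -size_poly_eq0 -opprB size_polyN size_XnsubC.
apply/funext => n; set Q := 1 - 'X^d.
have -> : fps_mul (fps_poly Q) f n = (Q * fps_trunc n.+1 f)`_n.
  rewrite coefM; apply: eq_bigr => i _.
  by rewrite coef_fps_trunc // ltnS leq_subr.
rewrite mulrBl mul1r coefB coefXnM coef_fps_trunc // /fps_poly [RHS]coef_poly.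
case: ltnP => [_|ledn]; first by rewrite subr0.
by rewrite coef_fps_trunc ?ltnS ?leq_subr // -{1}(subnK ledn) fP subrr.
Qed.

(** * Étale algebras over a finite field *)

Lemma expr_iter_card (R : pzSemiRingType) (x : R) q m n :
  x ^+ (q ^ m) = x -> x ^+ (q ^ (m * n)) = x.
Proof.
move=> xq; elim: n => [|n IHn]; first by rewrite muln0 expn0 expr1.
by rewrite mulnS expnD exprM xq.
Qed.

Lemma fieldExt_frob_period (F : finFieldType) (E : fieldExtType F) (x : E) :
  x ^+ (#|F| ^ \dim {:E}) = x.
Proof.
rewrite -[RHS](@expf_card (finvect_type E)); congr (x ^+ _).
by rewrite -(card_vspacef (Vector.class (finvect_type E))) card_vspace.
Qed.

(** Every factor of an étale algebra is a finite field, whose Frobenius has the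
    degree as period; the product of the degrees is a common period. *)
Lemma etale_frob_period (F : finFieldType) (A : algebra F) : etale A ->
  exists2 d, (0 < d)%N & forall a : A, a ^+ (#|F| ^ d) = a.
Proof.
case=> m [E] [pr] [_ _ [h prK _]].
exists (\prod_(i < m) \dim {:E i})%N.
  by apply: prodn_gt0 => i; apply: adim_gt0.
move=> a; apply: (can_inj prK); apply: functional_extensionality_dep => i.
rewrite rmorphXn (bigD1 i) //=.
exact/expr_iter_card/fieldExt_frob_period.
Qed.

Lemma etale_finType (F : finFieldType) (A : algebra F) : etale A ->
  exists (T : finType) (e : A -> T) (h : T -> A), cancel e h.
Proof.
case=> m [E] [pr] [_ _ [h prK _]].
pose T := {dffun forall i : 'I_m, finvect_type (E i)}.
exists T, (fun a => [ffun i => pr i a]), (fun t : T => h (fun i => t i)) => a.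
rewrite -[RHS]prK; congr (h _).
by apply: functional_extensionality_dep => i; rewrite ffunE.
Qed.

Lemma expr_fixed_seq (K : closedFieldType) N : (1 < N)%N ->
  exists rs : seq K, forall x, x ^+ N = x -> x \in rs.
Proof.
move=> N_gt1; set P : {poly K} := 'X^N - 'X.
have sP : size P = N.+1.
  by rewrite size_polyDl ?size_polyXn // size_polyN size_polyX.
have P0 : P != 0 by rewrite -size_poly_eq0 sP.
have [rs defP] := closed_field_poly_normal P.
exists rs => x xN; rewrite -root_prod_XsubC.
rewrite -(rootZ _ _ (a := lead_coef P)) ?lead_coef_eq0 // -defP.
by rewrite /root !hornerE xN subrr.
Qed.

Lemma algebra_homX (k : comPzRingType) (A B : algebra k) (f : A -> B) x n :
  algebra_hom f -> f (x ^+ n) = f x ^+ n.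
Proof.
case=> _ [f1 fM] _.
by elim: n => [|n IHn]; rewrite ?expr0 // !exprS fM IHn.
Qed.

(** A morphism is a map from a finite set, and its values lie in the finite set
    of elements of [K] fixed by a power of the Frobenius. *)
Lemma finite_etale_algebra_hom (F : finFieldType) (K : closedFieldType)
    (iota : {rmorphism F -> K}) (A : algebra F) :
  etale A -> finite_set (algebra_hom (A := A) (B := MkAlgebra iota)).
Proof.
move=> etA; have [d d_gt0 Ad] := etale_frob_period etA.
have [T [e [h eK]]] := etale_finType etA.
have [|rs rsP] := expr_fixed_seq K (N := #|F| ^ d).
  by rewrite -(exp1n d) ltn_exp2r // finRing_gt1.
pose ext (G : {ffun T -> seq_sub rs}) (a : A) : K := val (G (e a)).
apply: (sub_finite_set (B := range ext)); last first.
  exact/finite_image/finite_finset.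
move=> c c_hom; have c_rs a : c a \in rs.
  by apply: rsP; rewrite -[RHS](congr1 c (Ad a)) (algebra_homX _ _ c_hom).
exists [ffun t => SeqSub (c_rs (h t))] => //.
by apply/funext => a; rewrite /ext ffunE /= eK.
Qed.

(** * Counting points *)

Lemma set_bij_card_eq T U (X : set T) (Y : set U) f :
  set_bij X Y f -> (X #= Y)%card.
Proof.
move=> fb; rewrite card_eq_sym -(image_eq fb).
exact/inj_card_eq/(set_bij_inj fb).
Qed.

Lemma ncard_eq T U (X : set T) (Y : set U) : (X #= Y)%card -> ncard X = ncard Y.
Proof.
move=> XY; rewrite /ncard; congr xget; apply/funext => m; apply/propext.
split; last exact: card_eq_trans.
by apply: card_eq_trans; rewrite card_eq_sym.
Qed.

Section Points.

Variables (F : finFieldType) (K : closedFieldType) (iota : {rmorphism F -> K}).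
Variables (Q : cocorrespondence (finite_field_diff F)).
Variables (A : diffAlgebra (finite_field_diff F)).
Hypothesis presA : directly_presented Q A.

Lemma diff_hom_card_eq (B : diffAlgebra (finite_field_diff F)) :
  (diff_hom (A := A) (B := B) #= cocorr_points (Q := Q) (B := B))%card.
Proof. by case: presA => Phi [bPhi _]; apply: set_bij_card_eq (bPhi B). Qed.

Lemma finite_diff_hom n : @etale F (cocorr_tgt Q) ->
  finite_set (diff_hom (A := A) (B := kbar iota n)).
Proof.
move=> etC; rewrite (eq_finite_set (diff_hom_card_eq _)).
apply: sub_finite_set (finite_etale_algebra_hom iota etC).
by move=> c [].
Qed.

(** The twist by the [n]-th power of the Frobenius is only applied to values
    [c (p a)], which the [d]-th power fixes. *)
Lemma cocorr_points_periodic d n :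
  (forall a : cocorr_src Q, a ^+ (#|F| ^ d) = a) ->
  cocorr_points (Q := Q) (B := kbar iota (n + d))
    = cocorr_points (Q := Q) (B := kbar iota n).
Proof.
move=> Ad.
have twist (c : cocorr_tgt Q -> K) (a : cocorr_src Q) :
    algebra_hom (B := MkAlgebra iota) c ->
    frob iota (n + d) (c (cocorr_p Q a)) = frob iota n (c (cocorr_p Q a)).
  move=> c_hom; rewrite /frob addnC expnD exprM.
  by rewrite -(algebra_homX _ _ c_hom) -rmorphXn Ad.
apply/seteqP; split=> c [c_hom cQ]; split=> // a; rewrite -cQ.
  exact/esym/(twist c a c_hom).
exact: (twist c a c_hom).
Qed.

Lemma hom_count_periodic d n :
  (forall a : cocorr_src Q, a ^+ (#|F| ^ d) = a) ->
  hom_count iota A (n + d) = hom_count iota A n.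
Proof.
move=> Ad; apply: ncard_eq; apply: card_eq_trans (diff_hom_card_eq _) _.
by rewrite (cocorr_points_periodic n Ad) card_eq_sym; exact: diff_hom_card_eq.
Qed.

End Points.

Theorem theorem5p21 (F : finFieldType) (K : closedFieldType)
    (iota : {rmorphism F -> K}) (Kalg : is_algebraic_closure iota)
    (A : diffAlgebra (finite_field_diff F)) :
  etale_finitely_sigma_presented A ->
  (forall n : nat, (0 < n)%N ->
     finite_set (diff_hom (A := A) (B := kbar iota n)))
  /\ near_rational (diff_zeta iota A).
Proof.
case=> Q [etA0 etC0 presA]; split.
  by move=> n _; apply: finite_diff_hom presA _ etC0.
have [d d_gt0 Ad] := etale_frob_period etA0.
rewrite /near_rational /diff_zeta; set f : fps := fun n => _.
exists (fps_deriv f); split; first exact: fps_exp_log_deriv.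
apply: (fps_rational_periodic d_gt0) => n.
have fE m : fps_deriv f m = (hom_count iota A m.+1)%:R.
  by rewrite /fps_deriv /f /= -[LHS]mulr_natr divfK // pnatr_eq0.
by rewrite !fE -addSn (hom_count_periodic iota presA _ Ad).
Qed.
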